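(* Let $k$ be a positive integer and let $t$ be a nonnegative integer. Then: (i) If $n=4k+1$, then the number of iterations until the Collatz sequence starting at $n$ first reaches a number less than $n$ is $3$; in particular $T^3(4k+1)<4k+1$. (ii) If $n=16t+3$, then $T^6(n)<n$. (iii) If $n=32t+11$ or $n=32t+23$, then $T^8(n)<n$. (iv) If $n=128t+7$, $n=128t+15$, or $n=128t+59$, then $T^{11}(n)<n$. (v) If $n=256k+39$, $n=256k+79$, $n=256k+95$, $n=256k+123$, $n=256k+199$, or $n=256k+219$, then $T^{13}(n)<n$.
   Context: The Collatz map $T$ on the positive integers is $T(m)=m/2$ if $m$ is even and $T(m)=3m+1$ if $m$ is odd; $T^i$ denotes its $i$-fold iterate. The Collatz sequence starting at $n$ is $n, T(n), T^2(n),\dots$. *)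

(* Defs.v *)
From mathcomp Require Import all_boot.

Set Implicit Arguments.
Unset Strict Implicit.
Unset Printing Implicit Defensive.

(* The Collatz map lives on the positive integers, which it preserves; on [nat]
   it takes the junk value [collatz 0 = 0]. *)
Definition collatz (m : nat) : nat := if odd m then 3 * m + 1 else m %/ 2.

(* [s] is the number of iterations until the Collatz sequence starting at [n]
   first reaches a number less than [n]. *)
Definition first_descent (n s : nat) : Prop :=
  iter s collatz n < n /\ (forall i : nat, i < s -> n <= iter i collatz n).

(* Main.v *)
Require Import Defs.
From mathcomp Require Import all_boot.
From mathcomp Require Import zify.

(** The first steps of a Collatz sequence depend only on the residue of its
    starting value modulo a power of two.  If the first [s] steps from [b]
    consist of [o] odd steps and [h] halvings, then adding [2 ^ h.+1 * m] to
    [b] changes none of their parities: each halving consumes one factor 2 of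
    the added multiple, each odd step multiplies it by 3, and the last factor
    2 protects the parity of the value reached.  The perturbation
    thus arrives as [2 * 3 ^ o * m] ([iter_collatz_add]).

    When the value reached from [b] is even, one further halving spends the
    last factor 2, and [2 ^ h.+1 * m + b] is sent to [3 ^ o * m] plus the
    image of [b].  A whole residue class therefore descends as soon as its
    representative [b] does and [3 ^ o <= 2 ^ h.+1] ([residue_descent]), a
    finite computation.  The classes listed in the theorem have
    [3 ^ o / 2 ^ h.+1] equal to 3/4, 9/16, 27/32, 81/128 and 243/256.  Only the
    class of 1 modulo 4 has a representative that does not descend, since 1
    lies on the cycle 1, 4, 2; there the strict inequality [3 < 4] makes the
    numbers [4 * k + 1] with [0 < k] descend. *)

Definition odd_steps (s b : nat) : nat := count odd (traject collatz b s).

Definition halvings (s b : nat) : nat := count (predC odd) (traject collatz b s).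

Lemma odd_stepsS (s b : nat) :
  odd_steps s.+1 b = odd_steps s b + odd (iter s collatz b).
Proof. by rewrite /odd_steps trajectSr -cats1 count_cat /= addn0. Qed.

Lemma halvingsS (s b : nat) :
  halvings s.+1 b = halvings s b + ~~ odd (iter s collatz b).
Proof. by rewrite /halvings trajectSr -cats1 count_cat /= addn0. Qed.

Lemma collatz_odd (x : nat) : odd x -> collatz x = 3 * x + 1.
Proof. by rewrite /collatz => ->. Qed.

Lemma collatz_even (x : nat) : ~~ odd x -> collatz x = x %/ 2.
Proof. by rewrite /collatz => /negbTE->. Qed.

Lemma odd_double_add (a x : nat) : odd (2 * a + x) = odd x.
Proof. by rewrite oddD oddM. Qed.

(** The exponent is one more than the number of halvings so that the added
    term stays even, and hence invisible to the parity of the current value,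
    at every stage of the induction. *)
Lemma iter_collatz_add (s b m : nat) :
  iter s collatz (2 ^ (halvings s b).+1 * m + b)
  = 2 * (3 ^ odd_steps s b * m) + iter s collatz b.
Proof.
elim: s m => [|s IHs] m; first by rewrite /halvings /odd_steps /= expn0 mul1n.
rewrite !iterS halvingsS odd_stepsS.
have [xodd|xeven] := boolP (odd (iter s collatz b)).
  rewrite /= addn0 addn1 IHs !collatz_odd ?odd_double_add //.
  rewrite expnS; lia.
(* A halving raises the exponent, which is absorbed by doubling [m]. *)
rewrite /= addn0 addn1 expnSr -mulnA IHs !collatz_even ?odd_double_add //.
lia.
Qed.

(** The final halving makes the modulus sharp: it spends the factor 2 that
    [iter_collatz_add] keeps in reserve. *)
Lemma iter_collatz_add_even (s b m : nat) : ~~ odd (iter s collatz b) ->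
  iter s.+1 collatz (2 ^ (halvings s b).+1 * m + b)
  = 3 ^ odd_steps s b * m + iter s.+1 collatz b.
Proof.
move=> xeven; rewrite !iterS iter_collatz_add !collatz_even ?odd_double_add //.
lia.
Qed.

(** All hypotheses concern the representative [b] alone, so that a residue
    class is settled by evaluation; the modulus [c] is kept separate from the
    power of two in order to match a numeral. *)
Lemma residue_descent (s c b m : nat) :
  [&& ~~ odd (iter s collatz b), c == 2 ^ (halvings s b).+1,
      3 ^ odd_steps s b <= c & iter s.+1 collatz b < b] ->
  iter s.+1 collatz (c * m + b) < c * m + b.
Proof.
case/and4P=> xeven /eqP-> le_pow descends.
rewrite iter_collatz_add_even // -addnS.
by apply: leq_add => //; rewrite leq_mul2r le_pow orbT.
Qed.

Lemma collatz_orbit_mod4_1 (k : nat) :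
  [/\ iter 1 collatz (4 * k + 1) = 12 * k + 4,
      iter 2 collatz (4 * k + 1) = 6 * k + 2
    & iter 3 collatz (4 * k + 1) = 3 * k + 1].
Proof.
split; last exact: (@iter_collatz_add_even 2 1 k).
  have := iter_collatz_add 1 1 (2 * k).
  by rewrite !mulnA.
have := iter_collatz_add 2 1 k.
by rewrite !mulnA.
Qed.

Theorem theorem2p6 (k t : nat) (hk : 0 < k) :
  [/\ (forall n : nat, n = 4 * k + 1 ->
         first_descent n 3 /\ iter 3 collatz (4 * k + 1) < 4 * k + 1),
      (forall n : nat, n = 16 * t + 3 -> iter 6 collatz n < n),
      (forall n : nat, n = 32 * t + 11 \/ n = 32 * t + 23 ->
         iter 8 collatz n < n),
      (forall n : nat,
         [\/ n = 128 * t + 7, n = 128 * t + 15 | n = 128 * t + 59] ->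
         iter 11 collatz n < n)
    & (forall n : nat,
         n = 256 * k + 39 \/ n = 256 * k + 79 \/ n = 256 * k + 95 \/
         n = 256 * k + 123 \/ n = 256 * k + 199 \/ n = 256 * k + 219 ->
         iter 13 collatz n < n)].
Proof.
split=> n.
- move=> ->; have [T1 T2 T3] := collatz_orbit_mod4_1 k.
  have descends : iter 3 collatz (4 * k + 1) < 4 * k + 1 by rewrite T3; lia.
  do 2!split=> //.
  case=> [|[|[|i]]] // _; [rewrite T1 | rewrite T2]; lia.
- by move=> ->; apply: residue_descent; vm_compute.
- by case=> ->; apply: residue_descent; vm_compute.
- by case=> ->; apply: residue_descent; vm_compute.
- by do 5?[case=> [->|]; first by apply: residue_descent; vm_compute];
    move=> ->; apply: residue_descent; vm_compute.
Qed.
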